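(* Let $M={}_{f_2}M_1\times_{f_1}M_2$ with metric $g$ be a compact doubly warped product manifold. If the functions $k=\ln f_1$ and $l=\ln f_2$ (pulled back to $M$) are harmonic with respect to the Laplacian $\Delta$ of $(M,g)$, i.e. $\Delta k=0$ and $\Delta l=0$ on $M$, then $M$ is a usual (direct) product manifold of the form $M_1\times M_2$.
   Context: Let $(M_1,g_1)$ and $(M_2,g_2)$ be Riemannian manifolds, let $f_1$ and $f_2$ be positive smooth functions on $M_1$ and $M_2$ respectively, and let $\pi_i:M_1\times M_2\to M_i$ be the canonical projections. The doubly warped product manifold ${}_{f_2}M_1\times_{f_1}M_2$ is $M_1\times M_2$ equipped with the metric $g=(f_2\circ\pi_2)^2\pi_1^*(g_1)+(f_1\circ\pi_1)^2\pi_2^*(g_2)$. Put $k=\ln f_1$ and $l=\ln f_2$; the same symbols denote the pullbacks $k\circ\pi_1$, $l\circ\pi_2$ to $M$. The Laplacian $\Delta$ is the trace with respect to $g$ of the Hessian of $(M,g)$. ''$M$ is a usual product manifold of the form $M_1\times M_2$'' means that both $f_1$ and $f_2$ are constant, so that $g=c_2^2g_1\oplus c_1^2g_2$ with $c_1,c_2$ positive constants.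
   Formalization: The manifolds M_1 and M_2 are assumed non-empty and connected; on a disconnected compact manifold a harmonic k is only locally constant, so f_1 could take different constant values on different components and the claim would fail. *)

(* Defs.v *)
From HB Require Import structures.
From mathcomp Require Import all_boot all_order all_algebra.
From mathcomp Require Import all_classical all_reals all_analysis.

Set Implicit Arguments.
Unset Strict Implicit.
Unset Printing Implicit Defensive.

Import Order.TTheory GRing.Theory Num.Theory.
Import numFieldNormedType.Exports.

Local Open Scope classical_set_scope.
Local Open Scope ring_scope.

Section Coordinates.
Context {R : realType} {n : nat}.

Definition pderiv (i : 'I_n) (u : 'rV[R]_n -> R) : 'rV[R]_n -> R :=
  fun x => 'D_(delta_mx 0 i) u x.

Definition iter_pderiv (s : seq 'I_n) (u : 'rV[R]_n -> R) : 'rV[R]_n -> R :=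
  foldr pderiv u s.

(* u is C^oo on U, which is meant to be open: all the iterated partial
   derivatives of u exist and are continuous at every point of U. *)
Definition smooth_on (U : set 'rV[R]_n) (u : 'rV[R]_n -> R) : Prop :=
  forall (s : seq 'I_n) (x : 'rV[R]_n), U x ->
    {for x, continuous (iter_pderiv s u)} /\
    (forall i : 'I_n, derivable (iter_pderiv s u) x (delta_mx 0 i)).

End Coordinates.

(* A topological space together with a family of charts: coord c is meaningful
   on dom c only, and param c, its inverse, on the image of dom c only. *)
Record chartedSpace (R : realType) := ChartedSpace {
  carrier :> topologicalType ;
  dim : nat ;
  chart : Type ;
  dom : chart -> set carrier ;
  coord : chart -> carrier -> 'rV[R]_dim ;
  param : chart -> 'rV[R]_dim -> carrier
}.

Section Manifold.
Context {R : realType} (M : chartedSpace R).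

Definition chart_image (c : chart M) : set 'rV[R]_(dim M) := coord c @` dom c.

(* Manifolds are without boundary, connected and non-empty. *)
Record smooth_manifold : Prop := SmoothManifold {
  manifold_neq0 : [set: M] !=set0 ;
  manifold_connected : connected [set: M] ;
  manifold_hausdorff : hausdorff_space M ;
  manifold_second_countable : @second_countable M ;
  dom_cover : forall p : M, exists c : chart M, dom c p ;
  dom_open : forall c : chart M, open (dom c) ;
  image_open : forall c : chart M, open (chart_image c) ;
  coordK : forall (c : chart M) (p : M), dom c p -> param c (coord c p) = p ;
  coord_continuous : forall c : chart M, {within dom c, continuous (coord c)} ;
  param_continuous : forall c : chart M,
    {within chart_image c, continuous (param c)} ;
  transition_smooth : forall (c d : chart M) (j : 'I_(dim M)),
    smooth_on (coord c @` (dom c `&` dom d))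
              (fun x => coord d (param c x) 0 j)
}.

Definition smooth_function (u : M -> R) : Prop :=
  forall c : chart M, smooth_on (chart_image c) (u \o param c).

(* A covariant 2-tensor field, given by its components: h c x i j is its value
   on the coordinate vector fields d/dx_i and d/dx_j of the chart c, at the
   point with coordinates x. Only the values for x in chart_image c are
   meaningful. *)
Definition tensor2 : Type := chart M -> 'rV[R]_(dim M) -> 'M[R]_(dim M).

End Manifold.

(* The component in the chart c of the pullback F^* h, where h is read off in
   the chart d, which is meant to contain F (param c x). As Jacobian matrices
   act on row vectors on the right, (v, w) |-> h (dF v, dF w) has the matrix
   J H J^T. *)
Definition pullback {R : realType} {M N : chartedSpace R} (F : M -> N)
    (h : tensor2 N) (c : chart M) (d : chart N) (x : 'rV[R]_(dim M)) :
    'M[R]_(dim M) :=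
  let Fcd := fun y => coord d (F (param c y)) in
  jacobian Fcd x *m h d (Fcd x) *m (jacobian Fcd x)^T.

Section Riemannian.
Context {R : realType} {M : chartedSpace R} (g : tensor2 M).

(* metric_tensorial says that the components of g in overlapping charts are
   those of one and the same tensor field. *)
Record riemannian_metric : Prop := RiemannianMetric {
  metric_smooth : forall (c : chart M) (i j : 'I_(dim M)),
    smooth_on (chart_image c) (fun x => g c x i j) ;
  metric_sym : forall (c : chart M) (x : 'rV[R]_(dim M)),
    chart_image c x -> (g c x)^T = g c x ;
  metric_pos : forall (c : chart M) (x v : 'rV[R]_(dim M)),
    chart_image c x -> v != 0 -> 0 < (v *m g c x *m v^T) 0 0 ;
  metric_tensorial : forall (c d : chart M) (p : M), dom c p -> dom d p ->
    g c (coord c p) = pullback (fun q : M => q) g c d (coord c p)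
}.

(* The Christoffel symbol Gamma^k_ij of the Levi-Civita connection. *)
Definition christoffel (c : chart M) (k i j : 'I_(dim M))
    (x : 'rV[R]_(dim M)) : R :=
  2^-1 * \sum_(m < dim M) invmx (g c x) k m *
    (pderiv i (fun y => g c y j m) x + pderiv j (fun y => g c y i m) x
     - pderiv m (fun y => g c y i j) x).

Definition hessian (u : M -> R) : tensor2 M := fun c x =>
  \matrix_(i, j) (pderiv i (pderiv j (u \o param c)) x
    - \sum_(k < dim M) christoffel c k i j x * pderiv k (u \o param c) x).

(* The trace of the Hessian with respect to g, at the point with coordinates x
   in the chart c. *)
Definition laplacian (u : M -> R) (c : chart M) (x : 'rV[R]_(dim M)) : R :=
  \sum_(i < dim M) \sum_(j < dim M) invmx (g c x) i j * hessian u c x i j.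

Definition harmonic_function (u : M -> R) : Prop :=
  forall (c : chart M) (x : 'rV[R]_(dim M)),
    chart_image c x -> laplacian u c x = 0.

End Riemannian.

Section DoublyWarped.
Context {R : realType} (M1 M2 : chartedSpace R).

Definition product_space : chartedSpace R := {|
  carrier := (M1 * M2)%type ;
  dim := (dim M1 + dim M2)%N ;
  chart := (chart M1 * chart M2)%type ;
  dom := fun c => dom c.1 `*` dom c.2 ;
  coord := fun c p => row_mx (coord c.1 p.1) (coord c.2 p.2) ;
  param := fun c x => (param c.1 (lsubmx x), param c.2 (rsubmx x))
|}.

Definition proj1 (p : product_space) : M1 := p.1.
Definition proj2 (p : product_space) : M2 := p.2.

Definition doubly_warped_metric (g1 : tensor2 M1) (g2 : tensor2 M2)
    (f1 : M1 -> R) (f2 : M2 -> R) : tensor2 product_space :=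
  fun c x =>
    (f2 (proj2 (param c x))) ^+ 2 *: pullback proj1 g1 c c.1 x
    + (f1 (proj1 (param c x))) ^+ 2 *: pullback proj2 g2 c c.2 x.

(* The doubly warped product with warping functions f1, f2 is a usual product
   manifold: its metric is c2^2 pi_1^* g1 + c1^2 pi_2^* g2. *)
Definition usual_product (f1 : M1 -> R) (f2 : M2 -> R) : Prop :=
  exists c1 c2 : R,
    [/\ 0 < c1, 0 < c2, forall p, f1 p = c1 & forall q, f2 q = c2].

End DoublyWarped.

(* Main.v *)
From HB Require Import structures.
From mathcomp Require Import all_boot all_order all_algebra.
From mathcomp Require Import all_classical all_reals all_analysis.
From mathcomp Require Import ring lra.
Require Import Defs.

(** Both log-warping functions are constant because a harmonic function on a
    compact connected Riemannian manifold is constant ([harmonic_constant]);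
    it is applied on the product to the pullbacks of [ln \o f1] and
    [ln \o f2].

    That theorem needs no integration. In a chart the Laplacian is an elliptic
    operator: its second order coefficients form the inverse of the metric
    matrix, and its first order ones come from the Christoffel symbols. All
    that is used of the coefficients is that they are continuous and that the
    leading part is positive definite. By Hopf's [strong_maximum_principle]
    the set where a harmonic function attains its maximum is therefore open;
    it is closed, and nonempty by compactness, hence the whole manifold.

    The strong maximum principle is proved by a perturbation in one step.
    Suppose that [u <= m] with equality at [x0], but [u x1 < m] for some [x1]
    close to [x0]. Add to [u] a small multiple of
    [exp (- al * |x - x1|^2) - exp (- al * |x0 - x1|^2)], where the distance
    is Euclidean. On a box around [x1] the maximum of the sum is at least [m],
    the value at [x0]. It is attained neither close to [x1], where [u] is
    strictly smaller than [m], nor on the boundary of the box, where the added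
    term is negative. At an interior maximum the operator is nonpositive
    ([second_order_op_local_max]), whereas for large [al] it is positive on
    the perturbation away from [x1] ([second_order_op_gauss]).

    The doubly warped metric enters only through [warped_metric_C1]: its
    components are of class C1 and its matrices are symmetric and positive
    definite, so neither its Christoffel symbols nor the Laplacian of a
    pulled back function has to be computed.

    A smooth function is given by continuous iterated partial derivatives, so
    the chain rule and the second derivative test along lines depend on
    [differentiable_of_pderiv], by which continuous partial derivatives imply
    Frechet differentiability. *)

Set Implicit Arguments.
Unset Strict Implicit.
Unset Printing Implicit Defensive.

Import Order.TTheory GRing.Theory Num.Theory.
Import numFieldNormedType.Exports.

Local Open Scope classical_set_scope.
Local Open Scope ring_scope.

(** * Differentiability and linear forms *)

Section Differentiability.
Context {R : realType}.

Lemma continuous_sum_at {T : topologicalType} {I : Type} (r : seq I)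
    (F : I -> T -> R) (x : T) :
  (forall i, {for x, continuous (F i)}) ->
  {for x, continuous (fun y => \sum_(i <- r) F i y)}.
Proof.
move=> cF; elim: r => [|i r IH].
  rewrite (_ : (fun _ => _) = cst 0); first exact: cvg_cst.
  by apply/funext => y; rewrite big_nil.
rewrite (_ : (fun _ => _) = F i \+ fun y => \sum_(i <- r) F i y).
  exact: continuousD (cF i) IH.
by apply/funext => y; rewrite big_cons.
Qed.

Lemma ler_coord_norm {n} (v : 'rV[R]_n) i : `|v 0 i| <= `|v|.
Proof. by rewrite [leRHS]/Num.norm/= mx_normrE; apply: (le_bigmax _ _ (0, i)). Qed.

Definition linear_form {n} (c : 'I_n -> R) (v : 'rV[R]_n) : R :=
  \sum_i v 0 i * c i.

Lemma linear_form_is_linear n (c : 'I_n -> R) : linear (linear_form c).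
Proof.
move=> a u v; rewrite /linear_form scaler_sumr -big_split /=.
by apply: eq_bigr => i _; rewrite !mxE mulrDl [in RHS]/GRing.scale /= mulrA.
Qed.

HB.instance Definition _ n (c : 'I_n -> R) :=
  GRing.isLinear.Build R 'rV[R]_n R _ (linear_form c) (linear_form_is_linear c).

Lemma linear_form_continuous n (c : 'I_n -> R) : continuous (linear_form c).
Proof.
move=> x; apply: continuous_sum_at => i.
exact: (cvgMr_tmp (@matrix_normedtype.coord_continuous R 1 n 0 i x)).
Qed.

(** [differentiable] speaks of a differential given by choice and of little-o
    terms; the epsilon form lets one exhibit the differential. *)
Lemma differentiable_approx (V W : normedModType R) (u : V -> W) (x : V)
    (l : {linear V -> W}) : continuous l ->
  (forall e, 0 < e -> \forall h \near 0,
      `|u (h + x) - u x - l h| <= e * `|h|) ->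
  differentiable u x.
Proof.
move=> lc ul.
have E : u \o shift x = cst (u x) + l +o_ 0 id.
  apply/eqaddoP => e e0; near=> h.
  rewrite /= !fctE /= opprD addrA; near: h; exact: ul.
have [d1 d2] := (lc, diff_unique lc E).
by apply/diff_locallyP; rewrite d2.
Unshelve. all: by end_near. Qed.

Lemma differentiable_approxE (V W : normedModType R) (u : V -> W) (x : V) :
  differentiable u x -> forall e, 0 < e -> \forall h \near 0,
      `|u (h + x) - u x - 'd u x h| <= e * `|h|.
Proof.
move=> /diff_locally/eqaddoP du e e0; have := du e e0; apply: filterS => h.
by rewrite /= !fctE /= opprD addrA.
Qed.

Lemma near_eq_differentiable (V W : normedModType R) (u v : V -> W) (x : V) :
  (\near x, u x = v x) -> differentiable u x -> differentiable v x.
Proof.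
move=> uv du; apply: (@differentiable_approx _ _ _ _ ('d u x)).
  exact: diff_continuous.
move=> e e0; have := differentiable_approxE du e0.
have : \forall h \near (0:V), u (h + x) = v (h + x).
  by move: uv; rewrite (near_shift 0) subr0.
apply: filterS2 => h /= <-.
by rewrite (nbhs_singleton uv).
Qed.

Lemma near_eq_diff (V W : normedModType R) (u v : V -> W) (x : V) :
  (\near x, u x = v x) -> differentiable u x -> 'd v x = 'd u x :> (V -> W).
Proof.
move=> uv du; apply/funext => h.
by rewrite -!deriveE //; [apply/esym/near_eq_derive|exact: near_eq_differentiable uv du].
Qed.

End Differentiability.

(** * Functions of one real variable *)

Section Lines.
Context {R : realType}.

Lemma is_derive_line (V : normedModType R) (u : V -> R) (y v : V) (s l : R) :
  is_derive (s *: v + y) v u l -> is_derive s 1 (fun s => u (s *: v + y)) l.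
Proof.
have E : (fun h => h^-1 *: (u (h *: v + (s *: v + y)) - u (s *: v + y))) =
    (fun h => h^-1 *: (u ((h *: 1 + s) *: v + y) - u (s *: v + y))).
  by apply/funext => h; rewrite [h *: 1]mulr1 scalerDl addrA.
by move=> [du <-]; apply: DeriveDef; rewrite /derivable /derive /= -E.
Qed.

(** Writing the intermediate point as [c * t] treats both signs of [t] at once:
    it is the mean value theorem for [c |-> phi (c * t)] on [[0, 1]]. *)
Lemma mean_value_from0 (phi psi : R -> R) (r : R) :
  (forall s : R, `|s| < r -> is_derive s 1 phi (psi s)) ->
  forall t, `|t| < r ->
    exists2 c, 0 < c < 1 & phi t - phi 0 = psi (c * t) * t.
Proof.
move=> dphi t tr.
have cr (c : R) : 0 <= c <= 1 -> `|c * t| < r.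
  move=> /andP[c0 c1]; apply: le_lt_trans tr.
  by rewrite normrM ger0_norm // ler_piMl.
have dc (c : R) : 0 <= c <= 1 ->
    is_derive c 1 (fun c => phi (c * t)) (psi (c * t) * t).
  move=> /cr/dphi dct; have dm : is_derive c 1 (fun c : R => c * t) t.
    by apply: is_derive_eq; rewrite scaler0 add0r [LHS]mulr1.
  exact: (@is_derive1_comp R phi (fun c : R => c * t) c _ _ dct dm).
have [|//|c] := @MVT R (fun c => phi (c * t)) (fun c => psi (c * t) * t) 0 1 ltr01.
- by move=> c; rewrite in_itv /= => /andP[c0 c1]; apply: dc; rewrite !ltW.
- apply: continuous_in_subspaceT => c /set_mem /=; rewrite in_itv => /dc dct.
  exact/differentiable_continuous/derivable1_diffP.
by rewrite in_itv mul1r mul0r subr0 mulr1 => ? ?; exists c.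
Qed.

(** If [l] were positive, [psi] would be positive just to the right of [0], and
    [phi] would increase there. *)
Lemma second_derivative_test (phi psi : R -> R) (l : R) :
  (\forall t \near (0 : R), is_derive (t : R) 1 phi (psi t)) ->
  is_derive (0 : R) 1 psi l ->
  (\forall t \near 0, phi t <= phi 0) -> psi 0 = 0 /\ l <= 0.
Proof.
move=> dphi dpsi mx.
have [r /= r0 rP] : exists2 r, 0 < r & forall t : R, `|t| < r ->
    is_derive t 1 phi (psi t) /\ phi t <= phi 0.
  have /nbhs_ballP[r r0 rP] : nbhs (0 : R)
      [set t : R | is_derive t 1 phi (psi t) /\ phi t <= phi 0].
    exact: filterI.
  exists r => // t tr.
  by apply: rP; rewrite /ball /= sub0r normrN.
have psi0 : psi 0 = 0.
  have [_ <-] : is_derive (0:R) 1 phi (psi 0) by apply: (rP _ _).1; rewrite normr0.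
  have abs (t : R) : t \in `](-r), r[ -> `|t| < r.
    by rewrite in_itv /= ltr_norml.
  have [] // := @derive1_at_max R phi (-r) r 0.
  - by lra.
  - by move=> t /abs/rP[[]].
  - by rewrite in_itv /=; lra.
  - by move=> t /abs/rP[].
split => //; rewrite leNgt; apply/negP => l0.
have [] := dpsi; rewrite /derivable /derive psi0 => dd ll.
have /cvgrPdist_lt/(_ _ l0) : h^-1 *: (psi (h *: 1 + 0) - 0) @[h --> 0^'] --> l.
  by rewrite -{}ll.
case=> d /= d0 dP.
pose t := Num.min d r / 2.
have t0 : 0 < t by rewrite divr_gt0 // lt_min d0.
have [tr td] : t < r /\ t < d.
  have : Num.min d r <= r by rewrite ge_min lexx orbT.
  have : Num.min d r <= d by rewrite ge_min lexx.
  by rewrite /t; lra.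
have [||c /andP[c0 c1] E] := @mean_value_from0 phi psi r _ t.
- by move=> s /rP[].
- by rewrite gtr0_norm.
have ct0 : 0 < c * t by rewrite mulr_gt0.
have ctt : c * t < t by rewrite gtr_pMl.
have := dP (c * t); rewrite /ball_ /= sub0r normrN gtr0_norm // => /(_ _ _).
rewrite gt_eqF // [_ *: 1]mulr1 addr0 subr0 => /(_ (lt_trans ctt td) isT).
have := (rP t _).2; rewrite gtr0_norm // -subr_le0 E pmulr_lle0 // => /(_ tr) p0.
have : (c * t)^-1 *: psi (c * t) <= 0 by rewrite /GRing.scale /= pmulr_rle0 // invr_gt0.
by rewrite ltr_norml; lra.
Qed.

End Lines.

(** * Functions of class C1 and C2 *)

Section C1.
Context {R : realType} {n : nat}.
Implicit Types (u v : 'rV[R]_n -> R) (x y : 'rV[R]_n) (U : set 'rV[R]_n).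

Lemma norm_delta_mx_le1 (i : 'I_n) : `|delta_mx 0 i : 'rV[R]_n| <= 1.
Proof.
rewrite [leLHS]/Num.norm/= mx_normrE; apply: bigmax_le => // -[j k] _.
by rewrite mxE; case: eqP; case: eqP => _ _; rewrite ?normr1 ?normr0.
Qed.

(** The base point [y] varies along with the increment [t]: this uniformity is
    what allows increments in several coordinates to be chained in
    [partial_increment]. *)
Lemma pderiv_increment u x (i : 'I_n) :
  (\forall y \near x, derivable u y (delta_mx 0 i)) ->
  {for x, continuous (pderiv i u)} ->
  forall e, 0 < e -> exists2 d, 0 < d & forall y t, `|y - x| < d -> `|t| < d ->
    `|u (t *: delta_mx 0 i + y) - u y - t * pderiv i u x| <= e * `|t|.
Proof.
move=> du cu e e0.
have [r /= r0 rP] : exists2 r, 0 < r & forall y, `|y - x| < r ->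
    derivable u y (delta_mx 0 i) /\ `|pderiv i u y - pderiv i u x| <= e.
  have /nbhs_ballP[r r0 rP] : nbhs x [set y | derivable u y (delta_mx 0 i) /\
      `|pderiv i u y - pderiv i u x| <= e].
    apply: filterI => //; move/cvgrPdist_le : cu => /(_ _ e0).
    by apply: filterS => y; rewrite distrC.
  exists r => // y yr; apply: rP.
  by rewrite mx_norm_ball /ball_ /= distrC.
exists (r / 2) => [|y t yx tr]; first by rewrite divr_gt0.
have near_y (s : R) : `|s| < r / 2 -> `|s *: delta_mx 0 i + y - x| < r.
  move=> sr; rewrite -addrA (le_lt_trans (ler_normD _ _)) // normrZ.
  have := norm_delta_mx_le1 i; have := normr_ge0 s; nra.
have [|//|c /andP[c0 c1]] := @mean_value_from0 R
  (fun s => u (s *: delta_mx 0 i + y)) (fun s => pderiv i u (s *: delta_mx 0 i + y))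
  (r / 2) _ t.
  by move=> s /near_y/rP[dus _]; apply: is_derive_line; exact: derivableP.
rewrite scale0r add0r => ->; rewrite [t * _]mulrC -mulrBl normrM.
rewrite ler_wpM2r //; apply: (rP _ _).2; apply: near_y.
rewrite normrM gtr0_norm //; apply: le_lt_trans tr.
by rewrite ler_piMl // ltW.
Qed.

(** Moving along the coordinates listed in [s] one after the other, each step
    starts from a point still close to [x], so [pderiv_increment] applies. *)
Lemma partial_increment u x (s : seq 'I_n) :
  (forall i, \forall y \near x, derivable u y (delta_mx 0 i)) ->
  (forall i, {for x, continuous (pderiv i u)}) ->
  forall e, 0 < e -> exists2 d, 0 < d & forall y h : 'rV[R]_n, `|y - x| < d -> `|h| < d ->
    `|u (\sum_(i <- s) h 0 i *: delta_mx 0 i + y) - u y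
       - \sum_(i <- s) h 0 i * pderiv i u x| <= e * `|h|.
Proof.
move=> du cu; elim: s => [|i s IH] e e0.
  exists 1 => // y h _ _; rewrite !big_nil add0r subrr subr0 normr0.
  by rewrite mulr_ge0 // ltW.
have e20 : 0 < e / 2 by rewrite divr_gt0.
have [d1 d10 d1P] := IH _ e20.
have [d2 d20 d2P] := pderiv_increment (du i) (cu i) e20.
exists (Num.min (d1 / 2) d2) => [|y h]; first by rewrite lt_min d20 divr_gt0.
rewrite !lt_min => /andP[yd1 yd2] /andP[hd1 hd2].
rewrite !big_cons; set z := h 0 i *: delta_mx 0 i + y.
rewrite (_ : _ + _ + y = \sum_(j <- s) h 0 j *: delta_mx 0 j + z); last first.
  by rewrite -addrA addrCA.
have hi := ler_coord_norm h i.
have zd1 : `|z - x| < d1.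
  rewrite /z -addrA (le_lt_trans (ler_normD _ _)) // normrZ.
  have := norm_delta_mx_le1 i; have := normr_ge0 (h 0 i); nra.
have A1 := d1P z h zd1 (lt_trans hd1 _).
have A2 := d2P y (h 0 i) yd2 (le_lt_trans hi hd2).
set S := \sum_(j <- s) _ in A1 *; set T := \sum_(j <- s) _ in A1 *.
rewrite (_ : _ - _ - _ = (u (S + z) - u z - T) +
   (u z - u y - h 0 i * pderiv i u x)); last by ring.
rewrite (le_trans (ler_normD _ _)) //.
have {}/A1 : d1 / 2 < d1 by lra.
move: A2; rewrite -/z; move=> A2 A1.
have : e / 2 * `|h 0 i| <= e / 2 * `|h| by rewrite ler_wpM2l // ltW.
by lra.
Qed.

Lemma differentiable_of_pderiv u x :
  (forall i, \forall y \near x, derivable u y (delta_mx 0 i)) ->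
  (forall i, {for x, continuous (pderiv i u)}) -> differentiable u x.
Proof.
move=> du cu.
apply: (@differentiable_approx _ _ _ _ _ (linear_form (fun i => pderiv i u x))).
  exact: linear_form_continuous.
move=> e e0; have [d d0 dP] := partial_increment (index_enum 'I_n) du cu e0.
apply/nbhs_ballP; exists d => // h; rewrite mx_norm_ball /ball_ /= sub0r normrN => hd.
have := dP x h; rewrite subrr normr0 => /(_ d0 hd).
by rewrite -row_sum_delta.
Qed.

Lemma derive_pderiv u x (v : 'rV[R]_n) : differentiable u x ->
  'D_v u x = \sum_i v 0 i * pderiv i u x.
Proof.
move=> du; rewrite deriveE // {1}(row_sum_delta v) linear_sum.
by apply: eq_bigr => i _; rewrite linearZ /pderiv deriveE.
Qed.

(** Differentiability is made part of the definition because it gives the chain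
    rule; [smooth_on_C1] recovers it from the partial derivatives. *)
Definition C1_on U u := forall x, U x ->
  differentiable u x /\ forall i : 'I_n, {for x, continuous (pderiv i u)}.

Definition C2_on U u := C1_on U u /\ forall i : 'I_n, C1_on U (pderiv i u).

Lemma sub_C1_on (U V : set 'rV[R]_n) u : U `<=` V -> C1_on V u -> C1_on U u.
Proof. by move=> UV cu x /UV /cu. Qed.

Lemma sub_C2_on (U V : set 'rV[R]_n) u : U `<=` V -> C2_on V u -> C2_on U u.
Proof. by move=> UV [cu cdu]; split=> [|i]; exact: sub_C1_on UV _. Qed.

Lemma smooth_on_pderiv U u i : smooth_on U u -> smooth_on U (pderiv i u).
Proof.
move=> su s x Ux; have := su (rcons s i) x Ux.
by rewrite /iter_pderiv foldr_rcons.
Qed.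

Lemma smooth_on_C1 U u : open U -> smooth_on U u -> C1_on U u.
Proof.
move=> oU su x Ux; split=> [|i]; last exact: (su [:: i] x Ux).1.
apply: differentiable_of_pderiv => i; last exact: (su [:: i] x Ux).1.
by apply: filterS (open_nbhs_nbhs (conj oU Ux)) => y Uy; exact: (su [::] y Uy).2.
Qed.

Lemma smooth_on_C2 U u : open U -> smooth_on U u -> C2_on U u.
Proof.
move=> oU su; split=> [|i]; apply: smooth_on_C1 => //.
exact: smooth_on_pderiv.
Qed.

Lemma C1_on_continuous U u x : C1_on U u -> U x -> {for x, continuous u}.
Proof. by move=> cu /cu[du _]; exact: differentiable_continuous. Qed.

Lemma near_eq_pderiv u v x i :
  (\near x, u x = v x) -> pderiv i u x = pderiv i v x.
Proof. exact: near_eq_derive. Qed.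

Lemma near_eq_continuous_at (T : topologicalType) (f g : T -> R) (x : T) :
  (\near x, f x = g x) -> {for x, continuous f} -> {for x, continuous g}.
Proof.
move=> fg; rewrite /prop_for /continuous_at -(nbhs_singleton fg) => cf.
by apply: cvg_trans cf; exact: near_eq_cvg.
Qed.

Lemma open_near U x : open U -> U x -> \forall y \near x, U y.
Proof. by move=> oU Ux; exact: open_nbhs_nbhs. Qed.

Lemma eq_on_near U u v x : open U -> (forall x, U x -> u x = v x) -> U x ->
  \near x, u x = v x.
Proof. by move=> oU uv Ux; apply: filterS (open_near oU Ux) => y /uv. Qed.

Lemma eq_pderiv_on U u v i : open U -> (forall x, U x -> u x = v x) ->
  forall x, U x -> pderiv i u x = pderiv i v x.
Proof. by move=> oU uv x Ux; apply: near_eq_pderiv; exact: eq_on_near Ux. Qed.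

Lemma eq_C1_on U u v : open U -> (forall x, U x -> u x = v x) ->
  C1_on U u -> C1_on U v.
Proof.
move=> oU uv cu x Ux; have [du cdu] := cu x Ux; split=> [|i].
  exact: near_eq_differentiable (eq_on_near oU uv Ux) du.
apply: near_eq_continuous_at (cdu i).
by apply: eq_on_near Ux => //; exact: eq_pderiv_on.
Qed.

End C1.

(** * Sums, products and compositions *)

Section C1_algebra.
Context {R : realType} {n : nat}.
Implicit Types (u v : 'rV[R]_n -> R) (x y : 'rV[R]_n) (U : set 'rV[R]_n).

Lemma pderivD u v x i : differentiable u x -> differentiable v x ->
  pderiv i (fun x => u x + v x) x = pderiv i u x + pderiv i v x.
Proof. by move=> du dv; apply: deriveD; exact: diff_derivable. Qed.

Lemma pderivM u v x i : differentiable u x -> differentiable v x ->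
  pderiv i (fun x => u x * v x) x = u x * pderiv i v x + v x * pderiv i u x.
Proof. by move=> du dv; apply: deriveM; exact: diff_derivable. Qed.

Lemma pderiv_cst (c : R) x (i : 'I_n) : pderiv i (fun=> c) x = 0.
Proof. exact: derive_cst. Qed.

Lemma pderiv_comp (phi : R -> R) u x i (d : R) :
  differentiable u x -> is_derive (u x) 1 phi d ->
  pderiv i (fun x => phi (u x)) x = d * pderiv i u x.
Proof.
move=> du [/derivable1_diffP dphi <-]; rewrite /pderiv.
rewrite deriveE; last exact: (@differentiable_comp _ _ _ _ u phi).
rewrite (@diff_comp _ _ _ _ u phi) //= deriv1E; last exact/derivable1_diffP.
by rewrite -deriveE // -derive1E [LHS]mulrC.
Qed.

Lemma C1_on_cst U (c : R) : C1_on U (fun=> c).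
Proof.
move=> x Ux; split=> [|i]; first exact: differentiable_cst.
have -> : pderiv i (fun=> c) = cst 0 by apply/funext => y; exact: pderiv_cst.
exact: cst_continuous.
Qed.

Lemma C1_onD U u v : open U -> C1_on U u -> C1_on U v ->
  C1_on U (fun x => u x + v x).
Proof.
move=> oU cu cv x Ux; have [[du cdu] [dv cdv]] := (cu x Ux, cv x Ux).
split=> [|i]; first exact: differentiableD.
apply: near_eq_continuous_at (continuousD (cdu i) (cdv i)).
apply: filterS (open_near oU Ux) => y Uy.
by rewrite pderivD //; [exact: (cu y Uy).1|exact: (cv y Uy).1].
Qed.

Lemma C1_onM U u v : open U -> C1_on U u -> C1_on U v ->
  C1_on U (fun x => u x * v x).
Proof.
move=> oU cu cv x Ux; have [[du cdu] [dv cdv]] := (cu x Ux, cv x Ux).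
split=> [|i]; first exact: differentiableM.
have cux := C1_on_continuous cu Ux; have cvx := C1_on_continuous cv Ux.
apply: near_eq_continuous_at
  (continuousD (continuousM cux (cdv i)) (continuousM cvx (cdu i))).
apply: filterS (open_near oU Ux) => y Uy.
by rewrite pderivM //; [exact: (cu y Uy).1|exact: (cv y Uy).1].
Qed.

Lemma C1_on_sum U (I : Type) (r : seq I) (F : I -> 'rV[R]_n -> R) : open U ->
  (forall i, C1_on U (F i)) -> C1_on U (fun x => \sum_(i <- r) F i x).
Proof.
move=> oU cF; elim: r => [|i r IH].
  by apply: eq_C1_on (C1_on_cst 0) => // x _; rewrite big_nil.
by apply: eq_C1_on (C1_onD oU (cF i) IH) => // x _; rewrite big_cons.
Qed.

Lemma pderiv_sum (I : Type) (r : seq I) (F : I -> 'rV[R]_n -> R) x i :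
  (forall k, differentiable (F k) x) ->
  pderiv i (fun x => \sum_(k <- r) F k x) x = \sum_(k <- r) pderiv i (F k) x.
Proof.
move=> dF.
suff [] : differentiable (fun x => \sum_(k <- r) F k x) x /\
  pderiv i (fun x => \sum_(k <- r) F k x) x = \sum_(k <- r) pderiv i (F k) x by [].
elim: r => [|k r [IH1 IH2]].
  rewrite (_ : (fun _ => _) = cst 0); last by apply/funext => y; rewrite big_nil.
  by rewrite big_nil pderiv_cst; split => //; exact: differentiable_cst.
rewrite (_ : (fun _ => _) = (fun x => F k x + \sum_(k <- r) F k x)); last first.
  by apply/funext => y; rewrite big_cons.
rewrite big_cons pderivD // IH2; split => //.
exact: differentiableD.
Qed.

Lemma C2_onD U u v : open U -> C2_on U u -> C2_on U v ->
  C2_on U (fun x => u x + v x).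
Proof.
move=> oU [cu cdu] [cv cdv]; split=> [|i]; first exact: C1_onD.
apply: eq_C1_on (C1_onD oU (cdu i) (cdv i)) => // x Ux.
by rewrite pderivD //; [exact: (cu x Ux).1|exact: (cv x Ux).1].
Qed.

Lemma pderiv2D U u v x i j : open U -> C2_on U u -> C2_on U v -> U x ->
  pderiv i (pderiv j (fun x => u x + v x)) x =
    pderiv i (pderiv j u) x + pderiv i (pderiv j v) x.
Proof.
move=> oU [cu cdu] [cv cdv] Ux.
rewrite -pderivD; [|exact: (cdu j x Ux).1|exact: (cdv j x Ux).1].
apply: (eq_pderiv_on _ oU) => // y Uy.
by rewrite pderivD //; [exact: (cu y Uy).1|exact: (cv y Uy).1].
Qed.

Lemma C1_on_comp (phi phi1 : R -> R) U u : open U -> C1_on U u ->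
  (forall x, U x -> is_derive (u x) 1 phi (phi1 (u x))) ->
  (forall x, U x -> {for u x, continuous phi1}) ->
  C1_on U (fun x => phi (u x)).
Proof.
move=> oU cu dphi cphi x Ux; have [du cdu] := cu x Ux; split=> [|i].
  apply: (@differentiable_comp _ _ _ _ u phi) => //.
  by apply/derivable1_diffP; have [] := dphi x Ux.
have cux := C1_on_continuous cu Ux.
apply: near_eq_continuous_at
  (continuousM (continuous_comp cux (cphi x Ux)) (cdu i)).
apply: filterS (open_near oU Ux) => y Uy.
by rewrite /= (pderiv_comp i (cu y Uy).1 (dphi y Uy)).
Qed.

Lemma C2_on_comp (phi phi1 phi2 : R -> R) U u : open U -> C2_on U u ->
  (forall x, U x -> is_derive (u x) 1 phi (phi1 (u x))) ->
  (forall x, U x -> is_derive (u x) 1 phi1 (phi2 (u x))) ->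
  (forall x, U x -> {for u x, continuous phi2}) ->
  C2_on U (fun x => phi (u x)).
Proof.
move=> oU [cu cdu] dphi dphi1 cphi2.
have cphi1 : C1_on U (fun x => phi1 (u x)) by exact: C1_on_comp dphi1 cphi2.
split=> [|i].
  apply: C1_on_comp dphi _ => // x Ux; have [d1 _] := dphi1 x Ux.
  exact/differentiable_continuous/derivable1_diffP.
apply: eq_C1_on (C1_onM oU cphi1 (cdu i)) => // x Ux.
by rewrite (pderiv_comp i (cu x Ux).1 (dphi x Ux)).
Qed.

Lemma pderiv2_comp (phi phi1 phi2 : R -> R) U u x i j : open U -> C2_on U u ->
  (forall x, U x -> is_derive (u x) 1 phi (phi1 (u x))) ->
  (forall x, U x -> is_derive (u x) 1 phi1 (phi2 (u x))) -> U x ->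
  pderiv i (pderiv j (fun x => phi (u x))) x =
    phi1 (u x) * pderiv i (pderiv j u) x
    + phi2 (u x) * pderiv i u x * pderiv j u x.
Proof.
move=> oU [cu cdu] dphi dphi1 Ux.
rewrite -(eq_pderiv_on (u := fun x => phi1 (u x) * pderiv j u x) i oU) // => [|y Uy].
  have [d1 _] := dphi1 x Ux.
  rewrite (@pderivM (fun x => phi1 (u x))); last 2 first.
  - apply: (@differentiable_comp _ _ _ _ u phi1); first exact: (cu x Ux).1.
    exact/derivable1_diffP.
  - exact: (cdu j x Ux).1.
  by rewrite (pderiv_comp i (cu x Ux).1 (dphi1 x Ux)) [X in _ + X]mulrC.
by rewrite (pderiv_comp j (cu y Uy).1 (dphi y Uy)).
Qed.

Lemma C1_on_congruence U m p (A : 'rV[R]_n -> 'M[R]_m) (J : 'M[R]_(p, m)) :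
  open U -> (forall i j, C1_on U (fun z => A z i j)) ->
  forall i j, C1_on U (fun z => (J *m A z *m J^T) i j).
Proof.
move=> oU CA i j.
rewrite (_ : (fun z => _) =
    (fun z => \sum_k (\sum_l J i l * A z l k) * J j k)); last first.
  by apply/funext => z; rewrite mxE; apply: eq_bigr => k _; rewrite !mxE.
apply: C1_on_sum => // k; apply: C1_onM => //; last exact: C1_on_cst.
by apply: C1_on_sum => // l; apply: C1_onM => //; exact: C1_on_cst.
Qed.

Lemma C2_on_ln U u : open U -> C2_on U u ->
  (forall x, U x -> 0 < u x) -> C2_on U (fun x => ln (u x)).
Proof.
move=> oU cu u0.
apply: (@C2_on_comp _ GRing.inv (fun t => - t ^- 2)) => // x Ux.
- by apply: is_derive1_ln; exact: u0.
- have ux0 : u x != 0 by rewrite gt_eqF // u0.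
  apply: (is_derive_eq (is_deriveV ux0 (is_derive_id (u x) 1))).
  by rewrite [LHS]mulr1.
- have ux0 : u x != 0 by rewrite gt_eqF // u0.
  apply: continuousN; apply: continuousV; first by rewrite expf_neq0.
  exact: exprn_continuous.
Qed.

End C1_algebra.

Section C1_linear.
Context {R : realType} {m n : nat} (L : {linear 'rV[R]_m -> 'rV[R]_n}).
Hypothesis L_continuous : continuous L.
Implicit Types (u : 'rV[R]_n -> R) (V : set 'rV[R]_n).

Lemma pderiv_linear u z i : differentiable u (L z) ->
  pderiv i (fun z => u (L z)) z =
    \sum_j (L (delta_mx 0 i)) 0 j * pderiv j u (L z).
Proof.
move=> du; rewrite -derive_pderiv // /pderiv /derive.
rewrite (_ : (fun h => _) = (fun h : R =>
    h^-1 *: ((u \o shift (L z)) (h *: L (delta_mx 0 i)) - u (L z)))) //.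
by apply/funext => h /=; rewrite linearP.
Qed.

Lemma C1_on_linear u V : open V -> C1_on V u ->
  C1_on (L @^-1` V) (fun z => u (L z)).
Proof.
move=> oV cu z Vz; have [du cdu] := cu _ Vz; split=> [|i].
  by apply: (@differentiable_comp _ _ _ _ L u) => //; exact: linear_differentiable.
have oLV : open (L @^-1` V) by apply: open_comp => // y _; exact: L_continuous.
apply: (@near_eq_continuous_at _ _
   (fun z => \sum_j (L (delta_mx 0 i)) 0 j * pderiv j u (L z))).
  apply: filterS (open_near oLV Vz) => y Vy.
  by rewrite pderiv_linear //; exact: (cu _ Vy).1.
apply: continuous_sum_at => j; apply: continuousM; first exact: cst_continuous.
exact: (continuous_comp (@L_continuous z) (cdu j)).
Qed.

Lemma C2_on_linear u V : open V -> C2_on V u ->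
  C2_on (L @^-1` V) (fun z => u (L z)).
Proof.
move=> oV [cu cdu]; split=> [|i]; first exact: C1_on_linear.
have oLV : open (L @^-1` V) by apply: open_comp => // y _; exact: L_continuous.
apply: (@eq_C1_on _ _ _
   (fun z => \sum_j (L (delta_mx 0 i)) 0 j * pderiv j u (L z))) => //.
  by move=> z Vz; rewrite pderiv_linear //; exact: (cu _ Vz).1.
apply: C1_on_sum => // j; apply: C1_onM => //; first exact: C1_on_cst.
exact: C1_on_linear.
Qed.

End C1_linear.

Section Local_max.
Context {R : realType} {n : nat}.
Implicit Types (u v : 'rV[R]_n -> R) (x y : 'rV[R]_n) (U : set 'rV[R]_n).

(** The second derivative test is applied to [u] on each line through [z]. *)
Lemma C2_on_local_max U u z : open U -> C2_on U u -> U z ->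
  (\forall y \near z, u y <= u z) ->
  (forall i, pderiv i u z = 0) /\
  forall v : 'rV[R]_n,
    \sum_i \sum_j v 0 i * v 0 j * pderiv i (pderiv j u) z <= 0.
Proof.
move=> oU [cu cdu] Uz mx.
have H (v : 'rV[R]_n) : \sum_j v 0 j * pderiv j u z = 0 /\
    \sum_j v 0 j * 'D_v (pderiv j u) z <= 0.
  have lc : {for (0 : R), continuous (fun t : R => t *: v + z)}.
    apply: continuousD; last exact: cst_continuous.
    by apply: cvgZr_tmp; exact: cvg_id.
  have lc0 : (fun t : R => t *: v + z) @ (0 : R) --> z.
    by move: lc; rewrite /prop_for /continuous_at scale0r add0r.
  have [|||] := @second_derivative_test R (fun t => u (t *: v + z))
    (fun t => \sum_j v 0 j * pderiv j u (t *: v + z))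
    (\sum_j v 0 j * 'D_v (pderiv j u) z).
  - have : \forall t \near (0 : R), U (t *: v + z) := lc0 _ (open_near oU Uz).
    apply: filterS => t Ut.
    apply: is_derive_line; rewrite -derive_pderiv; last exact: (cu _ Ut).1.
    by apply: derivableP; apply: diff_derivable; exact: (cu _ Ut).1.
  - apply: (@is_derive_line _ _ (fun y => \sum_j v 0 j * pderiv j u y)).
    rewrite scale0r add0r.
    pose F j : 'rV[R]_n -> R := v 0 j *: pderiv j u.
    rewrite (_ : (fun y => _) = \sum_j F j); last first.
      by apply/funext => y; rewrite fct_sumE.
    apply: is_derive_sum => j; apply: is_deriveZ.
    by apply: derivableP; apply: diff_derivable; exact: (cdu _ _ Uz).1.
  - have : \forall t \near (0 : R), u (t *: v + z) <= u z := lc0 _ mx.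
    by apply: filterS => t; rewrite scale0r add0r.
  by rewrite scale0r add0r.
split=> [i|v].
  have [+ _] := H (delta_mx 0 i); rewrite (bigD1 i) //= mxE !eqxx mul1r big1 ?addr0 //.
  by move=> j ji; rewrite mxE eqxx (negbTE ji) mul0r.
have [_] := H v; rewrite exchange_big /=; congr (_ <= 0).
apply: eq_bigr => j _; rewrite derive_pderiv; last exact: (cdu _ _ Uz).1.
by rewrite mulr_sumr; apply: eq_bigr => i _; rewrite mulrCA mulrA.
Qed.

End Local_max.

(** * Traces of products of forms, and the squared distance *)

Section Trace.
Context {R : realType}.

Lemma sum2_recl n (F : 'I_n.+1 -> 'I_n.+1 -> R) :
  \sum_i \sum_j F i j = F ord0 ord0 + \sum_j F ord0 (lift ord0 j)
    + \sum_i F (lift ord0 i) ord0 + \sum_i \sum_j F (lift ord0 i) (lift ord0 j).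
Proof.
rewrite !big_ord_recl -!addrA; congr (_ + (_ + _)).
by rewrite -big_split; apply: eq_bigr => i _; rewrite big_ord_recl.
Qed.

(** A positive definite form is a sum of squares of linear forms, and on each
    square the sum is a value of the form [H]. The induction splits off one
    square by completing it, as in the Cholesky decomposition, and keeps the
    Schur complement [a'] of the first coefficient. *)
Lemma trace_posdef_nonpos_le0 n (a H : 'I_n -> 'I_n -> R) :
  (forall i j, a i j = a j i) ->
  (forall v : 'I_n -> R, (exists i, v i != 0) ->
     0 < \sum_i \sum_j v i * v j * a i j) ->
  (forall v : 'I_n -> R, \sum_i \sum_j v i * v j * H i j <= 0) ->
  \sum_i \sum_j a i j * H i j <= 0.
Proof.
elim: n a H => [|n IH] a H asym apos Hneg; first by rewrite big_ord0.
pose o := ord0 : 'I_n.+1.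
pose ext t (v : 'I_n -> R) i := if unlift o i is Some j then v j else t.
have exto t v : ext t v o = t by rewrite /ext unlift_none.
have extl t v j : ext t v (lift o j) = v j by rewrite /ext liftK.
have quad_ext t v (F : 'I_n.+1 -> 'I_n.+1 -> R) :
    \sum_i \sum_j ext t v i * ext t v j * F i j =
    t * t * F o o + t * (\sum_j v j * F o (lift o j))
    + t * (\sum_i v i * F (lift o i) o)
    + \sum_i \sum_j v i * v j * F (lift o i) (lift o j).
  rewrite sum2_recl !exto !mulr_sumr; congr (_ + _ + _ + _).
  - by apply: eq_bigr => j _; rewrite extl mulrA.
  - by apply: eq_bigr => j _; rewrite extl [_ * t]mulrC mulrA.
  - by apply: eq_bigr => i _; apply: eq_bigr => j _; rewrite !extl.
have a0 : 0 < a o o.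
  have := apos (ext 1 (fun=> 0)); rewrite quad_ext !mul1r.
  rewrite !big1 ?addr0 => [H1|i _|i _|i _]; rewrite ?mul0r //.
    by apply: H1; exists o; rewrite exto oner_eq0.
  by rewrite big1 // => j _; rewrite !mul0r.
pose a' (i j : 'I_n) := a (lift o i) (lift o j) - a o (lift o i) * a o (lift o j) / a o o.
have a'neg : \sum_i \sum_j a' i j * H (lift o i) (lift o j) <= 0.
  apply: IH => [i j|v [i vi]|v].
  - by rewrite /a' asym; congr (_ - _); ring.
    (* The first coordinate of the extension of v minimizes the form a, whose
       value becomes that of a' at v. *)
  - pose B := \sum_j v j * a o (lift o j).
    have := apos (ext (- B / a o o) v); rewrite quad_ext -/B.
    rewrite (_ : \sum_i v i * a (lift o i) o = B); last first.
      by apply: eq_bigr => j _; rewrite asym.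
    set Q := \sum_i _ => Hpos.
    rewrite (_ : \sum_i _ = Q - B * B / a o o).
      have <- : (- B / a o o * (- B / a o o) * a o o + - B / a o o * B + - B / a o o * B + Q)
          = Q - B * B / a o o by field; rewrite gt_eqF.
      by apply: Hpos; exists (lift o i); rewrite extl.
    rewrite /Q /B mulr_suml mulr_suml -sumrB; apply: eq_bigr => k _.
    rewrite mulr_sumr mulr_suml -sumrB; apply: eq_bigr => j _.
    by rewrite /a'; ring.
  - have := Hneg (ext 0 v); rewrite quad_ext !mul0r !add0r; exact.
have := Hneg (a o); rewrite sum2_recl -/o => Ha.
rewrite sum2_recl -/o.
set S := (X in X <= 0).
suff -> : S = (a o o)^-1 * (a o o * a o o * H o o +
    \sum_j a o o * a o (lift o j) * H o (lift o j) +
    \sum_i a o (lift o i) * a o o * H (lift o i) o +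
    \sum_i \sum_j a o (lift o i) * a o (lift o j) * H (lift o i) (lift o j)) +
    \sum_i \sum_j a' i j * H (lift o i) (lift o j).
  by rewrite -[leRHS]addr0 lerD // pmulr_rle0 // invr_gt0.
rewrite /S !mulrDr -!addrA; congr (_ + _); first by field; rewrite gt_eqF.
congr (_ + _).
  by rewrite mulr_sumr; apply: eq_bigr => j _; field; rewrite gt_eqF.
congr (_ + _).
  by rewrite mulr_sumr; apply: eq_bigr => j _; rewrite asym; field; rewrite gt_eqF.
rewrite mulr_sumr -big_split; apply: eq_bigr => i _ /=.
rewrite mulr_sumr -big_split; apply: eq_bigr => j _ /=.
by rewrite /a'; ring.
Qed.

End Trace.

Section Squared_distance.
Context {R : realType} {n : nat}.
Implicit Types (u v : 'rV[R]_n -> R) (x y c : 'rV[R]_n) (U : set 'rV[R]_n).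

Lemma differentiable_linear_form (l : 'I_n -> R) x : differentiable (linear_form l) x.
Proof. by apply: linear_differentiable; exact: linear_form_continuous. Qed.

Lemma pderiv_linear_form (l : 'I_n -> R) x i : pderiv i (linear_form l) x = l i.
Proof.
rewrite /pderiv deriveE; last exact: differentiable_linear_form.
rewrite diff_lin; last exact: linear_form_continuous.
rewrite /= /linear_form (bigD1 i) //= big1 ?addr0 ?mxE ?eqxx ?mul1r // => j ji.
by rewrite mxE (negbTE ji) andbF mul0r.
Qed.

Lemma C1_on_linear_form U (l : 'I_n -> R) : C1_on U (linear_form l).
Proof.
move=> x _; split=> [|i]; first exact: differentiable_linear_form.
rewrite (_ : pderiv i _ = cst (l i)); first exact: cst_continuous.
by apply/funext => y; rewrite pderiv_linear_form.
Qed.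

Definition coord_diff c k x : R := x 0 k - c 0 k.

Lemma coord_diffE c k :
  coord_diff c k = (fun x => linear_form (fun j => (j == k)%:R) x + (- c 0 k)).
Proof.
apply/funext => x; rewrite /coord_diff /linear_form (bigD1 k) //= eqxx mulr1.
by rewrite big1 ?addr0 // => j /negbTE ->; rewrite mulr0.
Qed.

Lemma C1_on_coord_diff U c k : open U -> C1_on U (coord_diff c k).
Proof.
move=> oU; rewrite coord_diffE; apply: C1_onD => //; last exact: C1_on_cst.
exact: C1_on_linear_form.
Qed.

Lemma pderiv_coord_diff c k x i : pderiv i (coord_diff c k) x = (i == k)%:R.
Proof.
rewrite coord_diffE pderivD; last exact: differentiable_cst.
  by rewrite pderiv_cst addr0 pderiv_linear_form.
exact: differentiable_linear_form.
Qed.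

(** Euclidean, whereas the norm of ['rV[R]_n] is the sup norm, which is not
    differentiable. *)
Definition sqdist c x : R := \sum_k coord_diff c k x * coord_diff c k x.

Lemma pderiv_sqdist c x i : pderiv i (sqdist c) x = 2 * coord_diff c i x.
Proof.
have dc k y : differentiable (coord_diff c k) y.
  by have [] := @C1_on_coord_diff setT c k openT y I.
rewrite /sqdist pderiv_sum => [|k]; last exact: differentiableM.
rewrite (bigD1 i) //= big1 => [|k ki].
  by rewrite pderivM // pderiv_coord_diff eqxx mulr1 addr0 mulr_natl mulr2n.
by rewrite pderivM // pderiv_coord_diff eq_sym (negbTE ki) mulr0 addr0.
Qed.

Lemma pderiv2_sqdist c x i j : pderiv i (pderiv j (sqdist c)) x = 2 * (i == j)%:R.
Proof.
rewrite (_ : pderiv j _ = (fun x => 2 * coord_diff c j x)); last first.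
  by apply/funext => y; rewrite pderiv_sqdist.
rewrite pderivM; last 2 first.
- exact: differentiable_cst.
- by have [] := @C1_on_coord_diff setT c j openT x I.
by rewrite pderiv_cst mulr0 addr0 pderiv_coord_diff.
Qed.

Lemma C2_on_sqdist U c : open U -> C2_on U (sqdist c).
Proof.
move=> oU; split=> [|i].
  by apply: C1_on_sum => // k; apply: C1_onM => //; exact: C1_on_coord_diff.
rewrite (_ : pderiv i _ = (fun x => 2 * coord_diff c i x)); last first.
  by apply/funext => y; rewrite pderiv_sqdist.
apply: C1_onM => //; [exact: C1_on_cst|exact: C1_on_coord_diff].
Qed.

Lemma sqdist_ge c x : `|x - c| ^+ 2 <= sqdist c x.
Proof.
have [->|xc] := eqVneq (x - c) 0.
  by rewrite normr0 expr0n; apply: sumr_ge0 => k _; exact: sqr_ge0.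
have /mx_norm_neq0[[i k] E] : mx_norm (x - c) != 0 by rewrite -normr_eq0 in xc.
rewrite [X in X ^+ 2]E /= /sqdist (bigD1 k) //= !mxE ord1 real_normK ?num_real //.
by rewrite lerDl; apply: sumr_ge0 => j _; exact: sqr_ge0.
Qed.

Lemma sqdist_le c x : sqdist c x <= n%:R * `|x - c| ^+ 2.
Proof.
rewrite (_ : _ * _ = \sum_(k < n) `|x - c| ^+ 2); last first.
  by rewrite sumr_const card_ord mulr_natl.
apply: ler_sum => k _; rewrite -expr2 -real_normK ?num_real // ler_sqr ?nnegrE //.
by have := ler_coord_norm (x - c) k; rewrite !mxE.
Qed.

End Squared_distance.

(** * The strong maximum principle *)

Section Maximum_principle.
Context {R : realType} {n : nat}.
Implicit Types (u v : 'rV[R]_n -> R) (x y c : 'rV[R]_n) (U : set 'rV[R]_n).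

Definition second_order_op (a : 'rV[R]_n -> 'I_n -> 'I_n -> R)
    (b : 'rV[R]_n -> 'I_n -> R) u x : R :=
  \sum_i \sum_j a x i j * pderiv i (pderiv j u) x + \sum_k b x k * pderiv k u x.

Record elliptic_on U (a : 'rV[R]_n -> 'I_n -> 'I_n -> R)
    (b : 'rV[R]_n -> 'I_n -> R) : Prop := EllipticOn {
  elliptic_continuous2 : forall x i j, U x -> {for x, continuous (fun y => a y i j)} ;
  elliptic_continuous1 : forall x i, U x -> {for x, continuous (fun y => b y i)} ;
  elliptic_sym : forall x i j, U x -> a x i j = a x j i ;
  elliptic_pos : forall x (v : 'I_n -> R), U x -> (exists i, v i != 0) ->
    0 < \sum_i \sum_j v i * v j * a x i j
}.

Section Second_order_operator.
Variables (U : set 'rV[R]_n) (a : 'rV[R]_n -> 'I_n -> 'I_n -> R)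
  (b : 'rV[R]_n -> 'I_n -> R).
Hypotheses (oU : open U) (ell : elliptic_on U a b).

(** At a local maximum the gradient vanishes and the Hessian is negative
    semidefinite, so only the trace of its product with [a] remains. *)
Lemma second_order_op_local_max u z : C2_on U u -> U z ->
  (\forall y \near z, u y <= u z) -> second_order_op a b u z <= 0.
Proof.
move=> cu Uz /(C2_on_local_max oU cu Uz)[d1 d2]; rewrite /second_order_op.
rewrite [X in _ + X]big1 ?addr0 => [|k _]; last by rewrite d1 mulr0.
apply: trace_posdef_nonpos_le0 => [i j|v|v].
- exact: (elliptic_sym ell).
- exact: (elliptic_pos ell).
- by have := d2 (\row_i v i); under eq_bigr do under eq_bigr do rewrite !mxE.
Qed.

Lemma second_order_opD u v x : C2_on U u -> C2_on U v -> U x ->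
  second_order_op a b (fun x => u x + v x) x =
  second_order_op a b u x + second_order_op a b v x.
Proof.
move=> cu cv Ux; rewrite /second_order_op addrACA; congr (_ + _); rewrite -big_split.
  apply: eq_bigr => i _; rewrite /= -big_split; apply: eq_bigr => j _ /=.
  by rewrite (pderiv2D _ _ oU) // mulrDr.
apply: eq_bigr => k _ /=; rewrite pderivD ?mulrDr //.
  by have [] := cu.1 x Ux.
by have [] := cv.1 x Ux.
Qed.

Lemma is_derive_expR_scale (al k t : R) :
  is_derive t 1 (fun t => k * expR (- al * t)) (- (al * (k * expR (- al * t)))).
Proof.
have dm : is_derive t 1 (fun t : R => - al * t) (- al).
  apply: (is_derive_eq (@is_deriveZ _ _ _ id (- al) _ _ _ (is_derive_id t 1))).
  by rewrite [LHS]mulr1.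
have de := @is_derive1_comp R expR (fun t => - al * t) t _ _ (is_derive_expR _) dm.
apply: (is_derive_eq (@is_deriveZ _ _ _ _ k _ _ _ de)).
by rewrite /GRing.scale /=; ring.
Qed.

Lemma continuous_expR_scale (al k t : R) :
  {for t, continuous (fun t => k * expR (- al * t))}.
Proof.
apply/differentiable_continuous/derivable1_diffP.
by have [] := is_derive_expR_scale al k t.
Qed.

(** The factor [2 * al] in the last bracket comes from the second derivative of
    the exponential: for large [al] it makes the positive quadratic form
    dominate every other term, wherever [x] stays away from [c]. *)
Lemma second_order_op_gauss (al k K : R) c x : U x ->
  let phi := fun t => k * expR (- al * t) + K in
  C2_on U (fun x => phi (sqdist c x)) /\
  second_order_op a b (fun x => phi (sqdist c x)) x =
  k * expR (- al * sqdist c x) * (2 * al) *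
   (2 * al * (\sum_i \sum_j coord_diff c i x * coord_diff c j x * a x i j)
    - (\sum_i a x i i + \sum_i b x i * coord_diff c i x)).
Proof.
move=> Ux phi.
pose phi1 t := (- al * k) * expR (- al * t).
pose phi2 t := (al * al * k) * expR (- al * t).
have d1 (t : R) : is_derive t 1 phi (phi1 t).
  apply: (is_derive_eq (@is_deriveD _ _ _ _ (cst K) _ _ _ _
    (is_derive_expR_scale al k t) (is_derive_cst _ _ _))).
  by rewrite addr0 /phi1; ring.
have d2 (t : R) : is_derive t 1 phi1 (phi2 t).
  apply: (is_derive_eq (is_derive_expR_scale al (- al * k) t)).
  by rewrite /phi2; ring.
have cq := C2_on_sqdist c oU.
split.
  apply: (@C2_on_comp _ _ phi phi1 phi2) => // y Uy; exact: continuous_expR_scale.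
rewrite /second_order_op.
set q := sqdist c x; set E := expR _.
rewrite (eq_bigr (fun i => 2 * phi1 q * a x i i + 4 * phi2 q *
   \sum_j coord_diff c i x * coord_diff c j x * a x i j)) => [|i _]; last first.
  rewrite (eq_bigr (fun j => 2 * phi1 q * (a x i j * (i == j)%:R) +
     4 * phi2 q * (coord_diff c i x * coord_diff c j x * a x i j))) => [|j _].
    rewrite big_split /= -!mulr_sumr; congr (_ * _ + _).
    rewrite (bigD1 i) //= eqxx mulr1 big1 ?addr0 // => j /negbTE ji.
    by rewrite eq_sym ji mulr0.
  rewrite (@pderiv2_comp _ _ phi phi1 phi2 U) //.
  by rewrite !pderiv_sqdist pderiv2_sqdist -/q; ring.
rewrite [X in _ + X](eq_bigr (fun i => 2 * phi1 q * (b x i * coord_diff c i x))) => [|i _]; last first.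
  rewrite (pderiv_comp i (cq.1 x Ux).1 (d1 _)) pderiv_sqdist -/q; ring.
rewrite big_split /= -!mulr_sumr /phi1 /phi2 -/E; ring.
Qed.

End Second_order_operator.

(** Hopf's maximum principle. If [u x1 < m] at some [x1] near [x0], then [u] plus
    a small multiple of a Gaussian centered at [x1], normalized to vanish at
    [x0], has an interior maximum at which the operator is positive. *)
Theorem strong_maximum_principle U a b u m x0 : open U -> elliptic_on U a b ->
  C2_on U u -> (forall x, U x -> 0 <= second_order_op a b u x) ->
  (forall x, U x -> u x <= m) -> U x0 -> u x0 = m ->
  \forall x \near x0, u x = m.
Proof.
move=> oU ell cu Lu um Ux0 ux0.
have /nbhs_ballP[r /= r0 rU] := open_near oU Ux0.
(* The box of radius T around x1 stays in U when x1 is closer than T to x0. As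
   the squared Euclidean norm is at most n times the squared sup norm, taking
   x1 closer than T / (n + 1) keeps x0 at Euclidean distance less than T. *)
pose T := r / 3; pose d := T / n.+1%:R.
have T0 : 0 < T by rewrite divr_gt0.
have d0 : 0 < d by rewrite divr_gt0.
have dT : d <= T by rewrite ler_pdivrMr // ler_peMr ?ler1n // ltW.
apply/nbhs_ballP; exists d => // x1; rewrite mx_norm_ball /ball_ /= => x01.
have BU x : `|x - x1| <= T -> U x.
  move=> xT; apply: rU; rewrite mx_norm_ball /ball_ /=.
  rewrite -(subrKA x1) (le_lt_trans (ler_normD _ _)) // [X in _ + X]distrC.
  by rewrite /T in dT xT *; lra.
have Ux1 : U x1 by apply: BU; rewrite subrr normr0 ltW.
apply/eqP; rewrite eq_le um //= leNgt; apply/negP => ux1.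
pose eta := (m - u x1) / 2.
have eta0 : 0 < eta by rewrite divr_gt0 // subr_gt0.
have [s /= s0 sP] : exists2 s, 0 < s & forall x, `|x - x1| < s -> u x < m - eta.
  have /cvgrPdist_lt/(_ _ eta0)/nbhs_ballP[s s0 sP] := C1_on_continuous cu.1 Ux1.
  exists s => // x xs; have := sP x; rewrite mx_norm_ball /ball_ /= distrC => /(_ xs).
  by rewrite ltr_norml /eta; lra.
have x0T : `|x0 - x1| <= T by rewrite ltW // (lt_le_trans x01).
have x0s : s <= `|x0 - x1|.
  by rewrite leNgt; apply/negP => /sP; rewrite ux0; lra.
have qx0 : sqdist x1 x0 < T ^+ 2.
  apply: le_lt_trans (sqdist_le _ _) _.
  have dn : d * n.+1%:R = T by rewrite /d divfK // pnatr_eq0.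
  have xd : `|x0 - x1| ^+ 2 <= d ^+ 2.
    by rewrite lerXn2r ?nnegrE //; exact: ltW.
  apply: (le_lt_trans (ler_wpM2l (ler0n R n) xd)).
  rewrite -dn -natr1 [ltRHS]exprMn [ltLHS]mulrC ltr_pM2l ?exprn_gt0 //.
  by have := ler0n R n; nra.
pose A := [set x | `|x - x1| <= T].
pose K := A `&` [set x | s <= `|x - x1|].
have cnorm : continuous (fun x : 'rV[R]_n => `|x - x1|).
  move=> x; apply: (@continuous_comp _ _ _ (fun x => x - x1) (fun x => `|x|)).
    by apply: continuousB; [exact: cvg_id|exact: cst_continuous].
  exact: norm_continuous.
have cA : compact A.
  apply: bounded_closed_compact.
    exists (T + `|x1|); split => //; first exact: num_real.
    move=> M TM x /= xA; rewrite -(subrK x1 x) (le_trans (ler_normD _ _)) //.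
    by rewrite ltW // (le_lt_trans _ TM) // lerD2r.
  by apply: (@closed_comp _ _ (fun x => `|x - x1|) [set t | t <= T]) => // x _;
    exact: closed_le.
have cK : compact K.
  apply: (subclosed_compact _ cA) => [|x []//]; apply: closedI.
    exact: compact_closed.
  by apply: (@closed_comp _ _ (fun x => `|x - x1|) [set t | s <= t]) => //;
    exact: closed_ge.
pose P x := \sum_i \sum_j coord_diff x1 i x * coord_diff x1 j x * a x i j.
pose Q x := \sum_i a x i i + \sum_i b x i * coord_diff x1 i x.
have P0 x : K x -> 0 < P x.
  case=> xT xs; apply: (elliptic_pos ell); first exact: BU.
  apply/not_existsP => x0'; move: xs; rewrite /= leNgt.
  suff -> : x - x1 = 0 by rewrite normr0 s0.
  apply/rowP => i; rewrite !mxE; apply/eqP; apply: contrapT => /negP.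
  exact: x0'.
have cd i x : {for x, continuous (coord_diff x1 i)}.
  exact: C1_on_continuous (@C1_on_coord_diff _ _ setT x1 i openT) I.
have cP x : U x -> {for x, continuous P}.
  move=> Ux; apply: continuous_sum_at => i; apply: continuous_sum_at => j.
  apply: continuousM; first exact: continuousM.
  exact: (elliptic_continuous2 ell).
have cQ x : U x -> {for x, continuous Q}.
  move=> Ux; apply: continuousD; apply: continuous_sum_at => i.
    exact: (elliptic_continuous2 ell).
  by apply: continuousM => //; exact: (elliptic_continuous1 ell).
(* On the compact set K, where z will be found, al only has to exceed half the
   maximum of Q / P; K contains x0, since u < m within distance s of x1. *)
have [al al0 alP] : exists2 al, 0 < al & forall x, K x -> Q x < 2 * al * P x.
  have [|||xm xmK xmP] := @EVT_max_rV R n (fun x => Q x / P x) K.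
  - by exists x0; split.
  - exact: cK.
  - apply: continuous_in_subspaceT => x /set_mem Kx; apply: continuousM.
      by apply: cQ; apply: BU; exact: Kx.1.
    apply: continuousV; first by rewrite gt_eqF // P0.
    by apply: cP; apply: BU; exact: Kx.1.
  exists (`|Q xm / P xm| + 1) => [|x Kx]; first by have := normr_ge0 (Q xm / P xm); lra.
  have := xmP x; rewrite inE => /(_ Kx); rewrite ler_pdivrMr ?P0 // => /le_lt_trans.
  apply; rewrite ltr_pM2r ?P0 //; have := ler_norm (Q xm / P xm).
  by have := normr_ge0 (Q xm / P xm); lra.
(* Within distance s of x1 the added term is less than ep, while u is below
   m - eta. *)
pose ep := eta / 2.
have ep0 : 0 < ep by rewrite divr_gt0.
pose w x := ep * expR (- al * sqdist x1 x) + (- ep * expR (- al * sqdist x1 x0)).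
have [cw _] := second_order_op_gauss a b oU al ep (- ep * expR (- al * sqdist x1 x0)) x1 Ux0.
pose v x := u x + w x.
have cv : C2_on U v by exact: C2_onD.
have vx0 : v x0 = m by rewrite /v /w ux0; ring.
have [|||z zA zP] := @EVT_max_rV R n v A.
- by exists x0.
- exact: cA.
- apply: continuous_in_subspaceT => x /set_mem Ax.
  by apply: (C1_on_continuous cv.1); exact: BU.
rewrite inE in zA.
have vz : m <= v z by rewrite -vx0; apply: zP; rewrite inE.
have zs : s <= `|z - x1|.
  rewrite leNgt; apply/negP => /sP uz.
  have : expR (- al * sqdist x1 z) <= 1.
    rewrite -expR0 ler_expR mulNr oppr_le0 mulr_ge0 ?(ltW al0) //.
    exact: le_trans (sqr_ge0 _) (sqdist_ge _ _).
  have : 0 < expR (- al * sqdist x1 x0) by exact: expR_gt0.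
  move: vz; rewrite /v /w /ep in ep0 *; nra.
have zT : `|z - x1| < T.
  rewrite lt_neqAle zA andbT; apply/eqP => zT.
  have : sqdist x1 x0 < sqdist x1 z.
    by apply: lt_le_trans qx0 _; rewrite -zT; exact: sqdist_ge.
  rewrite -(ltr_pM2l al0) -ltrN2 -!mulNr -ltr_expR -(ltr_pM2l ep0).
  have := um z (BU _ zA); move: vz; rewrite /v /w; lra.
have Uz : U z by exact: BU.
have : second_order_op a b v z <= 0.
  apply: (second_order_op_local_max oU) => //.
  have : open [set x | `|x - x1| < T].
    by apply: (@open_comp _ _ (fun x => `|x - x1|) [set t | t < T]) => [x _|];
      [exact: cnorm|exact: open_lt].
  move=> /open_near/(_ zT); apply: filterS => y yT; apply: zP.
  by rewrite inE /A /= ltW.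
have -> : second_order_op a b v z = second_order_op a b u z + second_order_op a b w z.
  exact: (@second_order_opD U a b oU u w z cu cw Uz).
have [_ Lw] := second_order_op_gauss a b oU al ep (- ep * expR (- al * sqdist x1 x0)) x1 Uz.
have Kz : K z by split.
have := alP z Kz => h.
apply/negP; rewrite -ltNge ltr_wpDl ?Lu //.
move: Lw; rewrite -/(w) -/(P z) -/(Q z) => ->.
by rewrite !mulr_gt0 ?expR_gt0 // subr_gt0.
Qed.

End Maximum_principle.

(** * Harmonic functions on a compact Riemannian manifold *)

Section Matrix_valued.
Context {R : realType} {T : topologicalType}.

Lemma continuous_prod_at {I : Type} (r : seq I) (F : I -> T -> R) (x : T) :
  (forall i, {for x, continuous (F i)}) ->
  {for x, continuous (fun y => \prod_(i <- r) F i y)}.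
Proof.
move=> cF; elim: r => [|i r IH].
  rewrite (_ : (fun _ => _) = cst 1); first exact: cst_continuous.
  by apply/funext => y; rewrite big_nil.
rewrite (_ : (fun _ => _) = F i \* fun y => \prod_(i <- r) F i y).
  exact: continuousM (cF i) IH.
by apply/funext => y; rewrite big_cons.
Qed.

Lemma continuous_det n (A : T -> 'M[R]_n) (x : T) :
  (forall i j, {for x, continuous (fun y => A y i j)}) ->
  {for x, continuous (fun y => \det (A y))}.
Proof.
move=> cA; apply: continuous_sum_at => s; apply: continuousM.
  exact: cst_continuous.
by apply: continuous_prod_at => i; exact: cA.
Qed.

Lemma continuous_invmx n (A : T -> 'M[R]_n) (x : T) :
  (forall i j, {for x, continuous (fun y => A y i j)}) ->
  (\forall y \near x, A y \in unitmx) ->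
  forall i j, {for x, continuous (fun y => invmx (A y) i j)}.
Proof.
move=> cA uA i j.
apply: (@near_eq_continuous_at _ _ (fun y => (\det (A y))^-1 * cofactor (A y) j i)).
  by apply: filterS uA => y Ay; rewrite /invmx Ay !mxE.
apply: continuousM.
  apply: continuousV; last exact: continuous_det.
  by rewrite -unitfE -unitmxE; exact: nbhs_singleton uA.
apply: continuousM; first exact: cst_continuous.
apply: continuous_det => k l.
rewrite (_ : (fun y => _) = (fun y => A y (lift j k) (lift i l))) //.
by apply/funext => y; rewrite !mxE.
Qed.

End Matrix_valued.

Section Posdef.
Context {R : realType} {n : nat}.

Lemma quadratic_formE (A : 'M[R]_n) (v : 'rV[R]_n) :
  (v *m A *m v^T) 0 0 = \sum_i \sum_j v 0 i * v 0 j * A i j.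
Proof.
rewrite mxE (eq_bigr (fun j => \sum_i v 0 i * v 0 j * A i j)) => [|j _].
  by rewrite exchange_big.
by rewrite !mxE mulr_suml; apply: eq_bigr => i _; rewrite mulrAC.
Qed.

Lemma posdef_unitmx (A : 'M[R]_n) :
  (forall v : 'rV[R]_n, v != 0 -> 0 < (v *m A *m v^T) 0 0) -> A \in unitmx.
Proof.
move=> Apos; rewrite unitmxE unitfE; apply/negP => /det0P[v v0 vA].
by have := Apos v v0; rewrite vA mul0mx mxE ltxx.
Qed.

(** The inverse form at [v] is the form of [A] at [v *m invmx A]. *)
Lemma posdef_invmx (A : 'M[R]_n) : A^T = A ->
  (forall v : 'rV[R]_n, v != 0 -> 0 < (v *m A *m v^T) 0 0) ->
  forall v : 'rV[R]_n, v != 0 -> 0 < (v *m invmx A *m v^T) 0 0.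
Proof.
move=> At Apos v v0; have uA := posdef_unitmx Apos.
have w0 : v *m invmx A != 0.
  by apply: contraNneq v0 => vA0; rewrite -(mulmxKV uA v) vA0 mul0mx.
have := Apos _ w0; rewrite trmx_mul trmx_inv At mulmxKV // mulmxA.
by [].
Qed.

End Posdef.

Section Harmonic.
Context {R : realType} {M : chartedSpace R} (g : tensor2 M).

(** These conditions transport the maximum principle from open sets of
    coordinates to the manifold, and they pass to a product one factor at a
    time. *)
Record chart_atlas : Prop := ChartAtlas {
  atlas_cover : forall p : M, exists c : chart M, dom c p ;
  atlas_dom_open : forall c : chart M, open (dom c) ;
  atlas_image_open : forall c : chart M, open (chart_image c) ;
  atlas_coordK : forall (c : chart M) (p : M), dom c p -> param c (coord c p) = p ;
  atlas_coord_continuous : forall (c : chart M) (p : M), dom c p ->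
    {for p, continuous (coord c)}
}.

(** One derivative of the metric is what makes the Christoffel symbols, and
    hence the coefficients of the Laplacian, continuous. *)
Record C1_metric : Prop := C1Metric {
  C1_metric_C1 : forall (c : chart M) (i j : 'I_(dim M)),
    C1_on (chart_image c) (fun x => g c x i j) ;
  C1_metric_sym : forall (c : chart M) (x : 'rV[R]_(dim M)),
    chart_image c x -> (g c x)^T = g c x ;
  C1_metric_pos : forall (c : chart M) (x v : 'rV[R]_(dim M)),
    chart_image c x -> v != 0 -> 0 < (v *m g c x *m v^T) 0 0
}.

(** The first order coefficients of the Laplacian. *)
Definition laplacian_drift (c : chart M) (x : 'rV[R]_(dim M)) (k : 'I_(dim M)) : R :=
  - \sum_i \sum_j invmx (g c x) i j * christoffel g c k i j x.

Lemma laplacian_second_order (u : M -> R) c x :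
  laplacian g u c x =
  second_order_op (fun x i j => invmx (g c x) i j) (laplacian_drift c)
    (u \o param c) x.
Proof.
rewrite /laplacian /second_order_op /laplacian_drift.
pose D k := pderiv k (u \o param c) x.
transitivity (\sum_i \sum_j invmx (g c x) i j * pderiv i (pderiv j (u \o param c)) x
   - \sum_i \sum_j \sum_k invmx (g c x) i j * christoffel g c k i j x * D k).
  rewrite -sumrB; apply: eq_bigr => i _; rewrite -sumrB; apply: eq_bigr => j _.
  rewrite mxE mulrBr mulr_sumr; congr (_ - _).
  by apply: eq_bigr => k _; rewrite mulrA.
congr (_ + _); rewrite -sumrN.
under eq_bigr do rewrite exchange_big -sumrN.
rewrite exchange_big; apply: eq_bigr => k _ /=.
rewrite -sumrN mulr_suml; apply: eq_bigr => i _.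
by rewrite mulNr mulr_suml.
Qed.

Lemma C1_metric_elliptic c : C1_metric -> open (chart_image c) ->
  elliptic_on (chart_image c) (fun x i j => invmx (g c x) i j) (laplacian_drift c).
Proof.
move=> [gC1 gsym gpos] oU.
have cinv x i j : chart_image c x ->
    {for x, continuous (fun y => invmx (g c y) i j)}.
  move=> Ux; apply: continuous_invmx.
    by move=> k l; exact: C1_on_continuous (gC1 c k l) Ux.
  apply: filterS (open_near oU Ux) => y Uy; apply: posdef_unitmx => v.
  exact: gpos.
split=> [x i j|x k Ux|x i j Ux|x v Ux [i vi]].
- exact: cinv.
- apply: continuousN; apply: continuous_sum_at => i; apply: continuous_sum_at => j.
  apply: continuousM; first exact: cinv.
  apply: continuousM; first exact: cst_continuous.
  apply: continuous_sum_at => m; apply: continuousM; first exact: cinv.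
  have cg i' j' l : {for x, continuous (pderiv l (fun y => g c y i' j'))}.
    exact: (gC1 c i' j' x Ux).2.
  by apply: continuousB => //; exact: continuousD.
- by rewrite -[in LHS](gsym _ _ Ux) -trmx_inv mxE.
- have := posdef_invmx (gsym c x Ux) (fun v => gpos c x v Ux) (v := \row_i v i).
  rewrite quadratic_formE; under eq_bigr do under eq_bigr do rewrite !mxE.
  apply; apply/eqP => /rowP/(_ i); rewrite !mxE => vi0.
  by rewrite vi0 eqxx in vi.
Qed.

(** The maximum set is nonempty by compactness, closed by continuity and open by
    the strong maximum principle in a chart around each of its points. *)
Theorem harmonic_constant (u : M -> R) : chart_atlas -> C1_metric ->
  compact [set: M] -> connected [set: M] ->
  (forall c, C2_on (chart_image c) (u \o param c)) -> harmonic_function g u ->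
  forall p q, u p = u q.
Proof.
move=> [cov odom oimg coordE ccoord] gC1 Mcomp Mconn uC2 uharm.
have ucont : continuous u.
  move=> p; have [c cp] := cov p.
  have ip : chart_image c (coord c p) by exists p.
  apply: (@near_eq_continuous_at _ _ ((u \o param c) \o coord c)).
    by apply: filterS (open_nbhs_nbhs (conj (odom c) cp)) => q cq /=; rewrite coordE.
  apply: continuous_comp; first exact: ccoord.
  exact: C1_on_continuous (uC2 c).1 ip.
suff [m um] : exists m, forall p, u p = m by move=> p q; rewrite !um.
have [[p0 _]|/set0P/negP/negPn/eqP M0] := pselect ([set: M] !=set0); last first.
  by exists 0 => p; have : [set: M] p by []; rewrite M0.
have [||pm _ pmax] := @compact_EVT_max M R u [set: M] _ Mcomp.
- by exists p0.
- exact: continuous_subspaceT.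
pose m := u pm.
have um p : u p <= m by apply: pmax; rewrite inE.
exists m => p; suff : [set p | u p = m] = setT by move/seteqP => [_]; exact.
apply: Mconn.
- by exists pm.
- exists [set p | u p = m]; last by rewrite setTI.
  rewrite openE => q /= uq; have [c cq] := cov q.
  have iq : chart_image c (coord c q) by exists q.
  have := @strong_maximum_principle R _ _ _ _ (u \o param c) m (coord c q)
    (oimg c) (C1_metric_elliptic gC1 (oimg c)) (uC2 c).
  have Lu x : chart_image c x -> 0 <= second_order_op
      (fun x i j => invmx (g c x) i j) (laplacian_drift c) (u \o param c) x.
    by move=> ix; rewrite -laplacian_second_order uharm.
  move=> /(_ Lu (fun x _ => um _) iq); rewrite /= coordE // => /(_ uq) near_m.
  have : \forall p \near q, u (param c (coord c p)) = m := ccoord c q cq _ near_m.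
  apply: filterS2 (open_nbhs_nbhs (conj (odom c) cq)) => r cr.
  by rewrite coordE.
- exists [set p | u p = m]; last by rewrite setTI.
  apply: (@closed_comp _ _ u [set t | t = m]); first by move=> *; exact: ucont.
  exact: closed_eq.
Qed.

End Harmonic.

Arguments chart_atlas {R} M.

(** * Doubly warped products *)

Section Product_topology.

(** The product is the union of the crosses made of one vertical slice and of the
    horizontal slice through [t0]; all of them contain [(s0, t0)]. *)
Lemma connected_setX_setT (S T : topologicalType) (t0 : T) (s0 : S) :
  connected [set: S] -> connected [set: T] -> connected [set: (S * T)%type].
Proof.
move=> cS cT.
pose cross s := (fun t : T => (s, t)) @` setT `|` (fun s : S => (s, t0)) @` setT.
have -> : [set: (S * T)%type] = \bigcup_(s in setT) cross s.
  by apply/esym/seteqP; split => // -[s t] _; exists s => //; left; exists t.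
apply: bigcup_connected => [|s _].
  by exists (s0, t0) => s _; right; exists s0.
apply: connectedU.
- by exists (s, t0); split; [exists t0|exists s].
- apply: connected_continuous_connected => //; apply: continuous_subspaceT => t.
  by apply: cvg_pair; [exact: cvg_cst|exact: cvg_id].
- apply: connected_continuous_connected => //; apply: continuous_subspaceT => t.
  by apply: cvg_pair; [exact: cvg_id|exact: cvg_cst].
Qed.

Lemma continuous_row_mx (R : realType) (T : topologicalType) n1 n2
    (f : T -> 'rV[R]_n1) (g : T -> 'rV[R]_n2) (x : T) :
  {for x, continuous f} -> {for x, continuous g} ->
  {for x, continuous (fun y => row_mx (f y) (g y))}.
Proof.
move=> cf cg A /nbhs_ballP[e /= e0 eA].
have Hf : \forall y \near x, ball (f x) e (f y) := cf _ (nbhsx_ballx (f x) e e0).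
have Hg : \forall y \near x, ball (g x) e (g y) := cg _ (nbhsx_ballx (g x) e e0).
rewrite /nbhs /=; apply: filterS2 Hf Hg => y [_ fy] [_ gy]; apply: eA; split => // i j.
by rewrite !mxE; case: (fintype.split j) => k; [exact: fy|exact: gy].
Qed.

End Product_topology.

Lemma manifold_atlas (R : realType) (M : chartedSpace R) :
  smooth_manifold M -> chart_atlas M.
Proof.
move=> HM; split.
- exact: dom_cover HM.
- exact: dom_open HM.
- exact: image_open HM.
- exact: coordK HM.
- move=> c p cp; have := @coord_continuous _ _ HM c.
  rewrite continuous_open_subspace; last exact: dom_open HM c.
  by apply; rewrite inE.
Qed.

Section Product.
Context {R : realType} (M1 M2 : chartedSpace R).
Local Notation M := (product_space M1 M2).

Lemma product_chart_image (c : chart M) : chart_image c =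
  (lsubmx @^-1` chart_image c.1) `&` (rsubmx @^-1` chart_image c.2).
Proof.
apply/seteqP; split=> [_ [p [p1 p2] <-]|z [[p1 d1 E1] [p2 d2 E2]]].
  by split; rewrite /= ?row_mxKl ?row_mxKr; [exists p.1|exists p.2].
by exists (p1, p2) => //=; rewrite E1 E2 hsubmxK.
Qed.

Lemma product_atlas : chart_atlas M1 -> chart_atlas M2 -> chart_atlas M.
Proof.
move=> [cov1 od1 oi1 cK1 cc1] [cov2 od2 oi2 cK2 cc2]; split.
- move=> [p1 p2]; have [c1 d1] := cov1 p1; have [c2 d2] := cov2 p2.
  by exists (c1, c2).
- move=> c; rewrite openE => -[p1 p2] [/= d1 d2].
  exists (dom c.1, dom c.2) => //=.
  by split; apply: open_nbhs_nbhs.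
- move=> c; rewrite product_chart_image; apply: openI.
    by apply: open_comp => // x _; exact: continuous_lsubmx.
  by apply: open_comp => // x _; exact: continuous_rsubmx.
- move=> c [p1 p2] [d1 d2] /=.
  by rewrite row_mxKl row_mxKr cK1 // cK2.
- move=> c p [d1 d2]; apply: continuous_row_mx.
    apply: (@continuous_comp _ _ _ (fun p : M1 * M2 => p.1)); first exact: cvg_fst.
    exact: cc1.
  apply: (@continuous_comp _ _ _ (fun p : M1 * M2 => p.2)); first exact: cvg_snd.
  exact: cc2.
Qed.

Lemma chart_coordK (N : chartedSpace R) (c : chart N) x : chart_atlas N ->
  chart_image c x -> coord c (param c x) = x.
Proof. by move=> aN [p cp <-]; rewrite atlas_coordK. Qed.

(** In product charts the projections read as [lsubmx] and [rsubmx], but only on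
    the image of the chart, which is why [L] agrees with the map only near
    [z]. *)
Lemma pullback_linear (N : chartedSpace R) (h : tensor2 N) (F : M -> N)
    (L : {linear 'rV[R]_(dim M1 + dim M2) -> 'rV[R]_(dim N)})
    (c : chart M) (d : chart N) z :
  continuous L -> (\forall z \near z, L z = coord d (F (param c z))) ->
  pullback F h c d z = lin1_mx L *m h d (L z) *m (lin1_mx L)^T.
Proof.
move=> Lc FL; rewrite /pullback -(nbhs_singleton FL).
suff -> : jacobian (fun z => coord d (F (param c z))) z = lin1_mx L by [].
apply/matrixP => i j; rewrite !mxE.
rewrite (near_eq_diff FL); last exact: linear_differentiable.
by rewrite diff_lin.
Qed.

Section Warped.
Variables (g1 : tensor2 M1) (g2 : tensor2 M2) (f1 : M1 -> R) (f2 : M2 -> R).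
Hypotheses (HM1 : chart_atlas M1) (HM2 : chart_atlas M2).

Let L1 : {linear 'rV[R]_(dim M1 + dim M2) -> 'rV[R]_(dim M1)} := lsubmx.
Let L2 : {linear 'rV[R]_(dim M1 + dim M2) -> 'rV[R]_(dim M2)} := rsubmx.

Lemma warped_metricE (c : chart M) z : chart_image c z ->
  doubly_warped_metric g1 g2 f1 f2 c z =
    (f2 (param c.2 (rsubmx z))) ^+ 2 *:
       (lin1_mx L1 *m g1 c.1 (lsubmx z) *m (lin1_mx L1)^T)
  + (f1 (param c.1 (lsubmx z))) ^+ 2 *:
       (lin1_mx L2 *m g2 c.2 (rsubmx z) *m (lin1_mx L2)^T).
Proof.
move=> Uz; have aM := product_atlas HM1 HM2.
have Un := open_near (@atlas_image_open _ _ aM c) Uz.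
rewrite /doubly_warped_metric; congr (_ *: _ + _ *: _).
  apply: pullback_linear; first exact: continuous_lsubmx.
  apply: filterS Un => y; rewrite product_chart_image => -[y1 _] /=.
  by rewrite chart_coordK.
apply: pullback_linear; first exact: continuous_rsubmx.
apply: filterS Un => y; rewrite product_chart_image => -[_ y2] /=.
by rewrite chart_coordK.
Qed.

Lemma C2_on_lsubmx (c : chart M) u : C2_on (chart_image c.1) u ->
  C2_on (chart_image c) (fun z => u (lsubmx z)).
Proof.
move=> cu; apply: (@sub_C2_on _ _ _ (L1 @^-1` chart_image c.1)).
  by rewrite product_chart_image => z [].
apply: C2_on_linear => //; first exact: continuous_lsubmx.
exact: atlas_image_open.
Qed.

Lemma C2_on_rsubmx (c : chart M) u : C2_on (chart_image c.2) u ->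
  C2_on (chart_image c) (fun z => u (rsubmx z)).
Proof.
move=> cu; apply: (@sub_C2_on _ _ _ (L2 @^-1` chart_image c.2)).
  by rewrite product_chart_image => z [].
apply: C2_on_linear => //; first exact: continuous_rsubmx.
exact: atlas_image_open.
Qed.

Hypotheses (Hg1 : riemannian_metric g1) (Hg2 : riemannian_metric g2)
  (Hf1 : smooth_function f1) (Hf2 : smooth_function f2)
  (f1_gt0 : forall p : M1, 0 < f1 p) (f2_gt0 : forall q : M2, 0 < f2 q).

(** For positivity: a nonzero vector has a nonzero component along one of the two
    factors, and the warping functions do not vanish. *)
Lemma warped_metric_C1 : C1_metric (doubly_warped_metric g1 g2 f1 f2).
Proof.
have aM := product_atlas HM1 HM2; split=> [c i j|c x Ux|c x v Ux v0].
- have oU := @atlas_image_open _ _ aM c.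
  have sm1 u : smooth_on (chart_image c.1) u -> C1_on (chart_image c) (fun z => u (lsubmx z)).
    by move=> /(smooth_on_C2 (@atlas_image_open _ _ HM1 c.1))/C2_on_lsubmx[].
  have sm2 u : smooth_on (chart_image c.2) u -> C1_on (chart_image c) (fun z => u (rsubmx z)).
    by move=> /(smooth_on_C2 (@atlas_image_open _ _ HM2 c.2))/C2_on_rsubmx[].
  have C1f1 := sm1 _ (@Hf1 c.1); have C1f2 := sm2 _ (@Hf2 c.2).
  have C1g1 k l := sm1 _ (@metric_smooth _ _ _ Hg1 c.1 k l).
  have C1g2 k l := sm2 _ (@metric_smooth _ _ _ Hg2 c.2 k l).
  pose G1 (z : 'rV[R]_(dim M1 + dim M2)) := lin1_mx L1 *m g1 c.1 (lsubmx z) *m (lin1_mx L1)^T.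
  pose G2 (z : 'rV[R]_(dim M1 + dim M2)) := lin1_mx L2 *m g2 c.2 (rsubmx z) *m (lin1_mx L2)^T.
  apply: (@eq_C1_on R (dim M) (chart_image c) (fun z : 'rV[R]_(dim M1 + dim M2) =>
      f2 (param c.2 (rsubmx z)) * f2 (param c.2 (rsubmx z)) * G1 z i j
    + f1 (param c.1 (lsubmx z)) * f1 (param c.1 (lsubmx z)) * G2 z i j)
    (fun z => doubly_warped_metric g1 g2 f1 f2 c z i j) oU).
    have lin_mxE (a b : R) (A B : 'M[R]_(dim M)) :
      (a *: A + b *: B) i j = a * A i j + b * B i j by rewrite !mxE.
    by move=> z Uz; rewrite warped_metricE // lin_mxE.
  apply: C1_onD => //; apply: C1_onM => //.
  + exact: C1_onM.
  + exact: C1_on_congruence.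
  + exact: C1_onM.
  + exact: C1_on_congruence.
- have := Ux; rewrite product_chart_image warped_metricE // => -[U1 U2].
  rewrite linearD !linearZ /= !trmx_mul !trmxK !mulmxA.
  by rewrite (metric_sym Hg1) // (metric_sym Hg2).
- have := Ux; rewrite product_chart_image warped_metricE // => -[U1 U2].
  have lin_mxE (a b : R) (A B : 'M[R]_1) :
    (a *: A + b *: B) 0 0 = a * A 0 0 + b * B 0 0 by rewrite !mxE.
  rewrite mulmxDr mulmxDl -!scalemxAr -!scalemxAl lin_mxE.
  have J (n : nat) (L : {linear 'rV[R]_(dim M1 + dim M2) -> 'rV[R]_n}) (A : 'M[R]_n) :
      v *m (lin1_mx L *m A *m (lin1_mx L)^T) *m v^T = L v *m A *m (L v)^T.
    by rewrite !mulmxA mul_rV_lin1 -mulmxA -trmx_mul mul_rV_lin1.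
  rewrite !J.
  have p1 := exprn_gt0 2 (f2_gt0 (param c.2 (rsubmx x))).
  have p2 := exprn_gt0 2 (f1_gt0 (param c.1 (lsubmx x))).
  have nn (n : nat) (A : 'M[R]_n) (w : 'rV[R]_n) :
      (forall w : 'rV[R]_n, w != 0 -> 0 < (w *m A *m w^T) 0 0) ->
      0 <= (w *m A *m w^T) 0 0.
    by have [->|w0] := eqVneq w 0; [rewrite !mul0mx mxE|move=> H; rewrite ltW ?H].
  have [l0|l0] := eqVneq (lsubmx v) 0.
    have r0 : rsubmx v != 0.
      by apply: contraNneq v0 => r0; rewrite -(hsubmxK v) l0 r0 row_mx0.
    apply: ltr_wpDl.
      by apply: mulr_ge0; [exact: ltW|apply: nn => w; exact: (metric_pos Hg1)].
    by rewrite mulr_gt0 // (metric_pos Hg2).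
  apply: ltr_wpDr.
    by apply: mulr_ge0; [exact: ltW|apply: nn => w; exact: (metric_pos Hg2)].
  by rewrite mulr_gt0 // (metric_pos Hg1).
Qed.

End Warped.

End Product.

Theorem theorem3p3 (R : realType) (M1 M2 : chartedSpace R)
    (g1 : tensor2 M1) (g2 : tensor2 M2) (f1 : M1 -> R) (f2 : M2 -> R)
    (HM1 : smooth_manifold M1) (HM2 : smooth_manifold M2)
    (Hg1 : riemannian_metric g1) (Hg2 : riemannian_metric g2)
    (Hf1 : smooth_function f1) (Hf2 : smooth_function f2)
    (f1_gt0 : forall p : M1, 0 < f1 p) (f2_gt0 : forall q : M2, 0 < f2 q)
    (M_compact : compact [set: product_space M1 M2])
    (k_harmonic : harmonic_function (doubly_warped_metric g1 g2 f1 f2)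
                     (fun p => ln (f1 (proj1 p))))
    (l_harmonic : harmonic_function (doubly_warped_metric g1 g2 f1 f2)
                     (fun p => ln (f2 (proj2 p)))) :
  usual_product f1 f2.
Proof.
have [[p0 _] [q0 _]] := (manifold_neq0 HM1, manifold_neq0 HM2).
have [a1 a2] := (manifold_atlas HM1, manifold_atlas HM2).
have gC1 := warped_metric_C1 a1 a2 Hg1 Hg2 Hf1 Hf2 f1_gt0 f2_gt0.
have aM := product_atlas a1 a2.
have conn : connected [set: product_space M1 M2].
  apply: connected_setX_setT; [exact: q0|exact: p0|exact: manifold_connected..].
have kC2 (c : chart (product_space M1 M2)) :
    C2_on (chart_image c) ((fun p => ln (f1 (proj1 p))) \o param c).
  apply: (@C2_on_ln R (dim (product_space M1 M2))) => [|| x _]; last exact: f1_gt0.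
    exact: atlas_image_open.
  apply: (@C2_on_lsubmx R M1 M2 a1 c (f1 \o param c.1)).
  by apply: smooth_on_C2; [exact: atlas_image_open|exact: Hf1].
have lC2 (c : chart (product_space M1 M2)) :
    C2_on (chart_image c) ((fun p => ln (f2 (proj2 p))) \o param c).
  apply: (@C2_on_ln R (dim (product_space M1 M2))) => [|| x _]; last exact: f2_gt0.
    exact: atlas_image_open.
  apply: (@C2_on_rsubmx R M1 M2 a2 c (f2 \o param c.2)).
  by apply: smooth_on_C2; [exact: atlas_image_open|exact: Hf2].
have kconst := harmonic_constant aM gC1 M_compact conn kC2 k_harmonic.
have lconst := harmonic_constant aM gC1 M_compact conn lC2 l_harmonic.
exists (f1 p0), (f2 q0); split => // [p|q].
  by apply: ln_inj; rewrite ?posrE //; exact: (kconst (p, q0) (p0, q0)).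
by apply: ln_inj; rewrite ?posrE //; exact: (lconst (p0, q) (p0, q0)).
Qed.
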